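(* Let $(h,\tau)\to(0,0)$ be a sequence of discretisation parameters along which the inverse-temperature interpolants $\theta_{h,\tau}$ of the fully discrete trajectories described in the context converge, $\theta_{h,\tau}\to\theta$ strongly in $L^2((0,T)\times\Omega)$ and a.e., and along which $$\varepsilon_q\theta_{h,\tau}^{-q}\,dx\ \stackrel{*}{\rightharpoonup}\ \varepsilon_q\theta^{-q}\,dx+\lambda\quad\text{in }L^\infty_{\rm w*}(0,T;\mathcal M(\overline\Omega)),$$ where $\lambda\in L^\infty_{\rm w*}(0,T;\mathcal M_+(\overline\Omega))$ is the defect measure. Put $g_{h,\tau}=\varepsilon_q\theta_{h,\tau}^{-q}$. The defect vanishes ($\lambda=0$) if any one of the following conditions holds: (i) the singular energies are uniformly integrable, $$\lim_{M\to\infty}\sup_{h,\tau}\int_{(0,T)\times\Omega}g_{h,\tau}\mathbf 1_{\{g_{h,\tau}>M\}}\,dx\,dt=0;$$ (ii) their space--time masses converge, $$\int_{(0,T)\times\Omega}g_{h,\tau}\,dx\,dt\longrightarrow\int_{(0,T)\times\Omega}\varepsilon_q\theta^{-q}\,dx\,dt;$$ (iii) for some $\delta>0$, $$\sup_{h,\tau}\int_{(0,T)\times\Omega}g_{h,\tau}^{1+\delta}\,dx\,dt<\infty .$$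
   Context: $\Omega=\mathbb T^d$, $1\le d\le 3$, flat torus; $T>0$; $q>1$, $q\ge d$, $\varepsilon_q>0$. $\mathcal M(\overline\Omega)=C(\overline\Omega)^*$ denotes finite signed Radon measures, $\mathcal M_+(\overline\Omega)$ the non-negative ones; $L^\infty_{\rm w*}(0,T;\mathcal M(\overline\Omega))\cong[L^1(0,T;C(\overline\Omega))]^*$ is the space of weak-star measurable, essentially bounded measure-valued maps with its weak-star convergence. The functions $\theta_{h,\tau}$ are forward piecewise-constant-in-time interpolants, $\theta_{h,\tau}=\theta_h^{n+1}$ on $(t^n,t^{n+1}]$, $t^n=n\tau$, $N\tau=T$, of strictly positive continuous piecewise affine periodic finite-element functions $\theta_h^n$ on meshes of size $h$ (inverse temperatures of a finite-element/implicit Euler scheme for a non-isothermal phase-field system) which satisfy $\sup_{h,\tau}\max_{0\le n\le N}\int_\Omega\big(\theta_h^n+(\theta_h^n)^{-q}\big)dx<\infty$, and $\theta>0$ a.e. is their limit, with $\theta\in L^2(0,T;H^1(\Omega))$ and $\theta^{-q}\in L^\infty(0,T;L^1(\Omega))$. The only features of the scheme on which the statement relies are those listed here and in the claim. *)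

(* Defs.v *)
From HB Require Import structures.
From mathcomp Require Import all_boot all_order all_algebra archimedean.
From mathcomp Require Import all_classical all_reals all_analysis.
From mathcomp Require Import measurable_realfun.

Set Implicit Arguments.
Unset Strict Implicit.
Unset Printing Implicit Defensive.

Import Order.TTheory GRing.Theory Num.Theory.
Import numFieldNormedType.Exports.

Local Open Scope classical_set_scope.
Local Open Scope ring_scope.

Section Torus.
Variables (R : realType) (d : nat).

Definition integer_row (z : 'rV[R]_d) : bool :=
  [forall i, z ord0 i \is a Num.int].

Definition torus_rel (x y : 'rV[R]_d) : bool := integer_row (x - y).

Lemma torus_rel_refl : reflexive torus_rel.
Proof. by move=> x; apply/forallP => i; rewrite subrr mxE rpred0. Qed.

Lemma torus_rel_sym : symmetric torus_rel.
Proof.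
move=> x y; apply/forallP/forallP => xy i; move: (xy i);
  by rewrite !mxE -opprB rpredN.
Qed.

Lemma torus_rel_trans : transitive torus_rel.
Proof.
move=> y x z /forallP xy /forallP yz; apply/forallP => i.
by move: (rpredD (xy i) (yz i)); rewrite !mxE addrA subrK.
Qed.

Canonical torus_equiv :=
  EquivRel torus_rel torus_rel_refl torus_rel_sym torus_rel_trans.

(* The flat torus R^d / Z^d with its quotient topology and Borel sets. *)
Definition torus : Type := quotient_topology {eq_quot torus_equiv}%qT.

HB.instance Definition _ := Topological.on torus.
HB.instance Definition _ := Quotient.on torus.
HB.instance Definition _ := isPointed.Build torus (\pi_torus (0 : 'rV[R]_d))%qT.
HB.instance Definition _ := Measurable.copy torus
  (g_sigma_algebraType (@open torus)).

Definition torus_pi (x : 'rV[R]_d) : torus := (\pi_torus x)%qT.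

End Torus.

Section CubeMeasure.
Variable R : realType.

Definition tcons d (p : measurableTypeR R * d.-tuple R) : d.+1.-tuple R := [tuple of p.1 :: p.2].

Lemma measurable_tcons d : measurable_fun [set: measurableTypeR R * d.-tuple R] (@tcons d).
Proof. exact: (@measurable_cons _ _ _ R fst d snd). Qed.

HB.instance Definition _ d :=
  isMeasurableFun.Build _ _ _ _ (@tcons d) (@measurable_tcons d).

(* Lebesgue measure on [0, 1]^d. *)
Fixpoint cube_measure d : probability (d.-tuple R) R :=
  if d is n.+1 then
    distribution (uniform_prob (@ltr01 R) \x cube_measure n)%E
      (@tcons n)
  else \d_([tuple]).

Definition row_of_tuple d (u : d.-tuple R) : 'rV[R]_d := \row_i tnth u i.

Lemma measurable_row_of_tuple d (U : set 'rV[R]_d) :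
  open U -> measurable (@row_of_tuple d @^-1` U).
Proof.
move=> oU.
pose B (c : d.-tuple rat) (n : nat) : set (d.-tuple R) :=
  \big[setI/setT]_(i < d) ((@tnth _ R ^~ i) @^-1` ball (ratr (tnth c i) : R) n.+1%:R^-1).
pose I := [set cn : d.-tuple rat * nat | B cn.1 cn.2 `<=` @row_of_tuple d @^-1` U].
have -> : @row_of_tuple d @^-1` U = \bigcup_(cn in I) B cn.1 cn.2.
  apply/seteqP; split => [u|u [cn] Icn]; last exact: Icn.
  move=> Uu; have /nbhs_ballP[e /= e0 eU] : nbhs (row_of_tuple u) U.
    exact: open_nbhs_nbhs.
  pose n := Num.truncn (2 / e).
  have ne : 2 * n.+1%:R^-1 < e.
    rewrite ltr_pdivrMr// mulrC -ltr_pdivrMr//; exact: truncnS_gt.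
  have n0 : 0 < n.+1%:R^-1 :> R by rewrite invr_gt0.
  have /(_ _)/cid : forall i, exists q : rat, ball (ratr q : R) n.+1%:R^-1 (tnth u i).
    move=> i; have /rat_in_itvoo[q] :
        tnth u i - n.+1%:R^-1 < tnth u i + n.+1%:R^-1.
      by rewrite ltrD2l gtrN.
    rewrite in_itv/= => /andP[q1 q2]; exists q; rewrite /ball/= ltr_distlC.
    by rewrite ltrBlDr q2 -ltrBlDr q1.
  move=> qP; pose c := [tuple sval (qP i) | i < d].
  have Bu : B c n u.
    rewrite /B -bigcap_seq => i _ /=; rewrite /c tnth_mktuple.
    by case: (qP i).
  exists (c, n) => // v Bv; apply: eU; split => // i j; rewrite !mxE.
  move: Bu Bv; rewrite /B -!bigcap_seq.
  move=> /(_ j (mem_index_enum j)) /= uc /(_ j (mem_index_enum j)) /= vc.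
  apply: (@le_ball _ _ _ (n.+1%:R^-1 + n.+1%:R^-1)); last first.
    by apply: ball_triangle vc; exact: ball_sym.
  by rewrite -mulr2n -[leLHS]mulr_natl ltW.
  have -> : \bigcup_(cn in I) B cn.1 cn.2 =
  \bigcup_cn (if `[< I cn >] then B cn.1 cn.2 else set0).
  apply/seteqP; split=> x [cn Icn Bx]; exists cn => //.
    by rewrite asboolT.
  by case: asboolP Bx.
  by case: asboolP Bx.
apply: countable_bigcupT_measurable => [|cn]; first exact: countableP.
case: ifP => // _; apply: bigsetI_measurable => i _.
rewrite -[X in measurable X]setTI; apply: measurable_tnth => //.
exact: measurable_ball.
Qed.

Definition torus_of_tuple d (u : d.-tuple R) : torus R d :=
  torus_pi (row_of_tuple u).

Lemma measurable_torus_of_tuple d :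
  measurable_fun [set: d.-tuple R] (@torus_of_tuple d).
Proof.
apply: (measurability (@open (torus R d))) => //.
by move=> _ [U oU <-]; rewrite setTI; exact: (@measurable_row_of_tuple d (@torus_pi R d @^-1` U) oU).
Qed.

HB.instance Definition _ d :=
  isMeasurableFun.Build _ _ _ _ (@torus_of_tuple d) (@measurable_torus_of_tuple d).

(* The Lebesgue measure dx on the torus, of total mass 1. *)
Definition dx d : probability (torus R d) R :=
  distribution (cube_measure d) (@torus_of_tuple d).

End CubeMeasure.
Arguments dx {R d}.

Section FiniteElements.
Variables (R : realType) (d : nat).

Definition barycentric (w : 'I_d.+1 -> R) : Prop :=
  (forall a, 0 <= w a) /\ \sum_a w a = 1.

Definition combination (w : 'I_d.+1 -> R) (v : 'I_d.+1 -> 'rV[R]_d) : 'rV[R]_d :=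
  \sum_a w a *: v a.

Definition simplex (v : 'I_d.+1 -> 'rV[R]_d) : set 'rV[R]_d :=
  [set combination w v | w in barycentric].

Definition face (v : 'I_d.+1 -> 'rV[R]_d) (S : set 'I_d.+1) : set 'rV[R]_d :=
  [set combination w v | w in [set w | barycentric w /\ forall a, ~ S a -> w a = 0]].

(* A conforming simplicial mesh of the torus, given by one representative in
   R^d of each simplex; the integer translates of the representatives
   triangulate R^d. *)
Record torus_mesh := TorusMesh {
  mesh_card : nat;
  mesh_simplex : 'I_mesh_card -> 'I_d.+1 -> 'rV[R]_d;
  mesh_nondegenerate : forall K, row_free
    (\matrix_(i < d) (mesh_simplex K (lift ord0 i) - mesh_simplex K ord0));
  mesh_cover : forall x, exists K z,
    integer_row z /\ simplex (mesh_simplex K) (x + z);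
  mesh_conforming : forall K L z, integer_row z ->
    simplex (fun a => mesh_simplex K a + z) `&` simplex (mesh_simplex L) `<=`
    face (mesh_simplex L)
      [set b | exists a, mesh_simplex L b = mesh_simplex K a + z] }.

Definition euclidean_norm (x : 'rV[R]_d) : R :=
  Num.sqrt (\sum_i x ord0 i ^+ 2).

(* The largest diameter of a simplex, i.e. the length of the longest edge. *)
Definition mesh_size (M : torus_mesh) : R :=
  \big[Num.max/0]_(K < mesh_card M) \big[Num.max/0]_a \big[Num.max/0]_b
    euclidean_norm (mesh_simplex K a - mesh_simplex K b).

Definition piecewise_affine (M : torus_mesh) (f : torus R d -> R) : Prop :=
  forall (K : 'I_(mesh_card M)) w, barycentric w ->
    f (torus_pi (combination w (mesh_simplex K))) =
    \sum_a w a * f (torus_pi (mesh_simplex K a)).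

Definition interpolant (tau : R) (N : nat) (u : nat -> torus R d -> R)
    (t : R) (x : torus R d) : R :=
  \sum_(n < N) \1_(`]n%:R * tau, n.+1%:R * tau]%classic : set R) t * u n.+1 x.

End FiniteElements.

Section FunctionSpaces.
Variables (R : realType) (d : nat).
Local Notation torus := (torus R d).
Local Notation leb := (@lebesgue_measure R).

Definition partial (i : 'I_d) (f : 'rV[R]_d -> R) (x : 'rV[R]_d) : R :=
  'D_('e_i) f x.

Definition smooth (phi : torus -> R) : Prop :=
  forall s : seq 'I_d, let f := foldr partial (phi \o @torus_pi R d) s in
    continuous f /\ forall i x, derivable f x 'e_i.

Definition torus_partial (i : 'I_d) (phi : torus -> R) (x : torus) : R :=
  partial i (phi \o @torus_pi R d) (repr x).

Definition weak_gradient (f : torus -> R) (G : 'I_d -> torus -> R) : Prop :=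
  forall i phi, smooth phi ->
    \int[dx]_x (f x * torus_partial i phi x) = - \int[dx]_x (G i x * phi x).

Variable T : R.

Definition QT : set (measurableTypeR R * torus) := `]0, T[%classic `*` setT.

Definition dtdx : set (measurableTypeR R * torus) -> \bar R :=
  (leb \x (dx : set torus -> \bar R))%E.

HB.instance Definition _ := Measure.on dtdx.

Definition in_L2 (f : R -> torus -> R) : Prop :=
  measurable_fun QT (fun p => f p.1 p.2) /\
  (\int[dtdx]_(p in QT) ((f p.1 p.2) ^+ 2)%:E < +oo)%E.

Definition in_L2H1 (f : R -> torus -> R) : Prop :=
  in_L2 f /\ exists G : 'I_d -> R -> torus -> R,
    (forall i, in_L2 (G i)) /\
    {ae leb, forall t, t \in `]0, T[ -> weak_gradient (f t) (fun i => G i t)}.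

Definition in_LinftyL1 (f : R -> torus -> R) : Prop :=
  measurable_fun QT (fun p => f p.1 p.2) /\
  exists C : R, {ae leb, forall t, t \in `]0, T[ ->
    (\int[dx]_x `|f t x|%:E <= C%:E)%E}.

Definition sup_norm (f : torus -> R) : \bar R :=
  ereal_sup [set `|f x|%:E | x in [set: torus]].

Definition simple_map (s : R -> torus -> R) : Prop :=
  exists m (A : 'I_m -> set R) (f : 'I_m -> torus -> R),
    (forall i, measurable (A i) /\ continuous (f i)) /\
    forall t x, s t x = \sum_i \1_(A i) t * f i x.

(* Bochner integrable maps (0,T) -> C(torus), through representatives that are
   limits of simple maps at every time. *)
Definition in_L1C (phi : R -> torus -> R) : Prop :=
  [/\ forall t, t \in `]0, T[ -> continuous (phi t),
      exists s : nat -> R -> torus -> R, (forall n, simple_map (s n)) /\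
        forall t, t \in `]0, T[ ->
          sup_norm (fun x => s n t x - phi t x) @[n --> \oo] --> 0%E
    & (\int[leb]_(t in `]0%R, T[) sup_norm (phi t) < +oo)%E].

(* M(torus) = C(torus)^*: measures act on continuous functions. *)
Definition functional := (torus -> R) -> R.

Definition of_density (g : torus -> R) : functional :=
  fun phi => \int[dx]_x (phi x * g x).

Definition of_measure (mu : {finite_measure set torus -> \bar R}) : functional :=
  fun phi => \int[mu]_x phi x.

(* The norm of a nonnegative measure is its total mass. *)
Definition in_Linfty_weakstar
    (mu : R -> {finite_measure set torus -> \bar R}) : Prop :=
  (forall phi, continuous phi ->
     measurable_fun `]0, T[ (fun t => of_measure (mu t) phi)) /\
  exists C : R, {ae leb, forall t, t \in `]0, T[ -> (mu t setT <= C%:E)%E}.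

Definition weakstar_cvg (mu_ : nat -> R -> functional) (mu : R -> functional) :=
  forall phi, in_L1C phi ->
    \int[leb]_(t in `]0, T[) mu_ k t (phi t) @[k --> \oo] -->
    \int[leb]_(t in `]0, T[) mu t (phi t).

Definition uniformly_integrable (g : nat -> R -> torus -> R) : Prop :=
  ereal_sup [set \int[dtdx]_(p in QT)
      (g k p.1 p.2 * \1_[set y | M < y] (g k p.1 p.2))%:E | k in [set: nat]]%E
    @[M --> +oo] --> 0%E.

End FunctionSpaces.
Arguments dtdx {R d}.
Arguments QT {R d}.

(* Main.v *)
Require Import Defs.
From HB Require Import structures.
From mathcomp Require Import all_boot all_order all_algebra archimedean.
From mathcomp Require Import all_classical all_reals all_analysis.
From mathcomp Require Import measurable_realfun.

Set Implicit Arguments.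
Unset Strict Implicit.
Unset Printing Implicit Defensive.

Import Order.TTheory GRing.Theory Num.Theory.
Import numFieldNormedType.Exports.

Local Open Scope classical_set_scope.
Local Open Scope ring_scope.

(** Testing the weak-star convergence against the constant 1 gives, by Tonelli,
    convergence of the space-time masses of g_k to the mass of the limit density
    plus the time integral of lambda_t(torus).  It therefore suffices that the
    limit of the masses does not exceed the mass of the limit density.  Under
    (ii) this is immediate; (iii) implies uniform integrability; and under (i)
    one truncates g_k at a height M: the truncations converge in L^1 by dominated
    convergence, and the tails above M are small uniformly in k. *)

(** * Continuity of powers and measurability of the interpolants *)

Lemma cvg_powR {R : realType} {I : Type} {F : set_system I} {FF : Filter F}
    (u : I -> R) (a p : R) :
  0 < a -> u x @[x --> F] --> a -> u x `^ p @[x --> F] --> a `^ p.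
Proof.
move=> a0 ua; have : expR (p * ln (u x)) @[x --> F] --> expR (p * ln a).
  apply: (@cvg_comp _ _ _ (fun x => p * ln (u x)) expR _ (nbhs (p * ln a)));
    last exact: continuous_expR.
  apply: cvgM; first exact: cvg_cst.
  by apply: (@cvg_comp _ _ _ u (@ln R) _ (nbhs a)) => //; exact: continuous_ln.
(* [powR] has a separate clause at base [0]; since [a] is positive, [u] eventually avoids it and the
   exponential formula applies. *)
rewrite [in X in _ -> X]/powR (gt_eqF a0); apply: cvg_trans; apply: near_eq_cvg.
have : \forall x \near F, 0 < u x by exact: (cvgr_gt a ua).
by apply: filterS => x ux; rewrite /powR gt_eqF.
Qed.

Lemma continuous_torus_measurable {R : realType} {d : nat}
    (f : torus R d -> R) :
  continuous f -> measurable_fun setT f.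
Proof.
move=> cf; apply: (measurability _ (RGenOInfty.measurableE R)).
move=> _ [_ [x ->] <-]; rewrite setTI.
apply: sub_sigma_algebra; move/continuousP : cf; apply.
exact: interval_open.
Qed.

Lemma measurable_interpolant {R : realType} {d : nat} (tau : R) (N : nat)
    (u : nat -> torus R d -> R) :
  (forall n, (n <= N)%N -> continuous (u n)) ->
  measurable_fun [set: measurableTypeR R * torus R d]
    (fun p => interpolant tau N u p.1 p.2).
Proof.
move=> cu; apply: measurable_sum => n; apply: measurable_funM.
  have mI : measurable_fun setT
      (\1_(`]n%:R * tau, n.+1%:R * tau]%classic : set R) : R -> R).
    exact: measurable_indic.
  exact: (measurableT_comp mI measurable_fst).
have mu := continuous_torus_measurable (cu _ (ltn_ord n)).
exact: (measurableT_comp mu measurable_snd).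
Qed.

Lemma measurable_indic_gt {R : realType} (M : R) :
  measurable_fun setT (\1_[set y | M < y] : R -> R).
Proof.
apply: measurable_indic.
rewrite (_ : [set y | M < y] = `]M, +oo[%classic); first exact: measurable_itv.
by apply/seteqP; split => y /=; rewrite in_itv/= andbT.
Qed.

(** * Passage to the limit in integrals with uniformly small tails *)

Section limit_of_tight_integrals.
Context d (X : measurableType d) (R : realType).
Variables (mu : {measure set X -> \bar R}) (D : set X).
Hypotheses (mD : measurable D) (muD : (mu D < +oo)%E).

(** Pointwise, [g k] is at most [min (g k) M] plus its tail above [M]. The first term passes to the
    limit, where it is at most [g_lim]; the second costs at most [e], which is arbitrary. *)
Lemma tight_integral_limit_le (g : nat -> X -> R) (g_lim : X -> R) (L : \bar R) :
  (forall k, measurable_fun D (g k)) -> measurable_fun D g_lim ->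
  (forall k x, D x -> 0 <= g k x) -> (forall x, D x -> 0 <= g_lim x) ->
  {ae mu, forall x, D x -> g k x @[k --> \oo] --> g_lim x} ->
  (forall e, 0 < e -> exists2 M, 0 < M & forall k,
    (\int[mu]_(x in D) (g k x * \1_[set y | M < y] (g k x))%:E <= e%:E)%E) ->
  (\int[mu]_(x in D) (g k x)%:E)%E @[k --> \oo] --> L ->
  (L <= \int[mu]_(x in D) (g_lim x)%:E)%E.
Proof.
move=> mg mgl g0 gl0 gcvg tight gL; apply/lee_addgt0Pr => e e0.
have [M M0 tailM] := tight e e0.
have mmin (f : X -> R) : measurable_fun D f ->
    measurable_fun D (fun x => (Num.min (f x) M)%:E).
  by move=> mf; apply/measurable_EFinP; exact: measurable_minr.
have min0 (a : R) : 0 <= a -> 0 <= Num.min a M.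
  by move=> a0; rewrite le_min a0 ltW.
have [_ _ mincvg] : [/\ mu.-integrable D (fun x => (Num.min (g_lim x) M)%:E),
   [sequence \int[mu]_(x in D) `|(Num.min (g k x) M)%:E -
     (Num.min (g_lim x) M)%:E|]_k%E @ \oo --> 0%E &
   [sequence \int[mu]_(x in D) (Num.min (g k x) M)%:E]_k%E @ \oo -->
     (\int[mu]_(x in D) (Num.min (g_lim x) M)%:E)%E].
  (* The dominating function is the constant [M], integrable because [D] has finite measure. *)
  apply: (@dominated_convergence _ _ _ mu D mD
    (fun k x => (Num.min (g k x) M)%:E) _ (cst M%:E)).
  - by move=> k; exact: mmin.
  - exact: mmin.
  - apply: filterS gcvg => x gx Dx; apply: cvg_EFin; first exact: nearW.
    have cmin : {for g_lim x, continuous (fun y : R^o => Num.min y M)}.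
      by apply: continuous_min; [exact: cvg_id | exact: cvg_cst].
    by apply: (continuous_cvg _ cmin); exact: gx.
  - apply/integrableP; split; first exact: measurable_cst.
    by rewrite integral_cst//= lte_mul_pinfty// lee_fin normr_ge0.
  - apply/aeW => x k Dx /=.
    by rewrite lee_fin ger0_norm ?ge_min ?lexx ?orbT// min0// g0.
apply: (@le_trans _ _ (\int[mu]_(x in D) (Num.min (g_lim x) M)%:E + e%:E)%E).
  apply: (lee_cvg_to gL (cvgeD _ mincvg (cvg_cst e%:E))).
    by rewrite fin_num_adde_defl.
  apply: nearW => k /=.
  apply: le_trans (leeD2l _ (tailM k)).
  have mtail : measurable_fun D
      (fun x => (g k x * \1_[set y | M < y] (g k x))%:E).
    apply/measurable_EFinP; apply: measurable_funM => //.
    exact: measurableT_comp (measurable_indic_gt M) _.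
  have tail0 x : D x -> (0 <= (g k x * \1_[set y | M < y] (g k x))%:E)%E.
    by move=> Dx; rewrite lee_fin mulr_ge0// g0.
  rewrite -ge0_integralD//; last 2 first.
  - by move=> x Dx; rewrite lee_fin min0// g0.
  - exact: mmin.
  apply: ge0_le_integral => //.
  - by move=> x Dx; rewrite lee_fin g0.
  - by apply/measurable_EFinP.
  - by apply: emeasurable_funD => //; exact: mmin.
  move=> x Dx; rewrite -EFinD lee_fin indicE.
  (* Below [M] the truncation already equals [g k x], and above [M] the tail does. At height exactly
     [M] the strict indicator vanishes, but the truncation is still [g k x]. *)
  case: (ltP (g k x) M) => [gM|Mg].
    by rewrite lerDl mulr_ge0// g0.
  move: Mg; rewrite le_eqVlt => /predU1P[<-|Mg].
    by rewrite lerDl mulr_ge0// ltW.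
  by rewrite mem_set//= mulr1 lerDr ltW.
apply: leeD2r; apply: ge0_le_integral => //.
- by move=> x Dx; rewrite lee_fin min0// gl0.
- exact: mmin.
- by apply/measurable_EFinP.
- by move=> x Dx; rewrite lee_fin ge_min lexx.
Qed.

Lemma superlinear_moment_tail_le (g : X -> R) (M delta : R) :
  0 < M -> 0 < delta -> measurable_fun D g -> (forall x, D x -> 0 <= g x) ->
  (\int[mu]_(x in D) (g x * \1_[set y | M < y] (g x))%:E <=
   (M `^ (- delta))%:E * \int[mu]_(x in D) (g x `^ (1 + delta))%:E)%E.
Proof.
move=> M0 d0 mg g0.
have mpow : measurable_fun D (fun x => (g x `^ (1 + delta))%:E).
  apply/measurable_EFinP.
  by apply: (measurableT_comp (measurable_powR _)).
rewrite -ge0_integralZl//; last 2 first.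
- by move=> x Dx; rewrite lee_fin powR_ge0.
- by rewrite lee_fin powR_ge0.
apply: ge0_le_integral => //.
- by move=> x Dx; rewrite lee_fin mulr_ge0// g0.
- apply/measurable_EFinP; apply: measurable_funM => //.
  exact: measurableT_comp (measurable_indic_gt M) _.
- exact: measurable_funeM.
move=> x Dx; rewrite -EFinM lee_fin indicE.
have [/[!inE]/= Mg|_] := boolP (_ \in _); last first.
  by rewrite mulr0 mulr_ge0// powR_ge0.
have gx0 : 0 < g x by exact: lt_trans Mg.
rewrite mulr1 [X in _ * X]powRD; last by rewrite (gt_eqF gx0) implybT.
rewrite (powRr1 (ltW gx0)) mulrCA ler_pMr//.
rewrite powRN mulrC ler_pdivlMr ?powR_gt0// mul1r.
by apply: ge0_ler_powR; rewrite ?nnegrE ?ltW.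
Qed.

Lemma bounded_moments_tight (g : nat -> X -> R) (delta : R) :
  0 < delta -> (forall k, measurable_fun D (g k)) ->
  (forall k x, D x -> 0 <= g k x) ->
  (ereal_sup [set \int[mu]_(x in D) (g k x `^ (1 + delta))%:E
             | k in [set: nat]] < +oo)%E ->
  forall e, 0 < e -> exists2 M, 0 < M & forall k,
    (\int[mu]_(x in D) (g k x * \1_[set y | M < y] (g k x))%:E <= e%:E)%E.
Proof.
move=> d0 mg g0 supfin e e0.
pose S := ereal_sup [set (\int[mu]_(x in D) (g k x `^ (1 + delta))%:E)%E
                    | k in [set: nat]].
have leS k : (\int[mu]_(x in D) (g k x `^ (1 + delta))%:E <= S)%E.
  by apply: ereal_sup_ubound; exists k.
have S0 : (0 <= S)%E.
  by apply: le_trans (leS 0%N); apply: integral_ge0 => x _; rewrite lee_fin powR_ge0.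
have Sfin : S \is a fin_num by rewrite ge0_fin_numE.
pose s := fine S + 1.
have s0 : 0 < s by rewrite ltr_wpDl ?fine_ge0.
exists ((s / e) `^ delta^-1) => [|k].
  exact/powR_gt0/divr_gt0.
apply: le_trans (superlinear_moment_tail_le _ d0 (mg k) (g0 k)) _.
  exact/powR_gt0/divr_gt0.
rewrite -powRrM mulrN mulVf ?gt_eqF// powR_inv1 ?invf_div; last exact/ltW/divr_gt0.
apply: (@le_trans _ _ ((e / s)%:E * s%:E)%E); last first.
  by rewrite -EFinM divfK ?gt_eqF.
apply: lee_wpmul2l; first by rewrite lee_fin ltW ?divr_gt0.
apply: le_trans (leS k) _.
by rewrite -(fineK Sfin) lee_fin lerDl.
Qed.

End limit_of_tight_integrals.

(** * From extended-real to real integrals, and Tonelli on a slab *)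

Lemma ae_bounded_integral_fine d (X : measurableType d) (R : realType)
    (mu : {measure set X -> \bar R}) (D : set X) (F : X -> \bar R) (C : R) :
  measurable D -> (mu D < +oo)%E -> measurable_fun D F ->
  (forall x, D x -> 0 <= F x)%E -> {ae mu, forall x, D x -> (F x <= C%:E)%E} ->
  mu.-integrable D (EFin \o (fine \o F)) /\
  (\int[mu]_(x in D) F x)%E = (\int[mu]_(x in D) fine (F x))%:E.
Proof.
move=> mD muD mF F0 FC.
(* [fine] changes [F] only at infinite values, which the bound confines to a null set. *)
have eqF : ae_eq mu D F (EFin \o (fine \o F)).
  apply: filterS FC => x FC Dx /=; rewrite fineK// ge0_fin_numE ?F0//.
  by rewrite (le_lt_trans (FC Dx)) ?ltry.
have mfF : measurable_fun D (EFin \o (fine \o F)).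
  by apply/measurable_EFinP; apply: measurableT_comp.
have intfF : mu.-integrable D (EFin \o (fine \o F)).
  apply/integrableP; split => //.
  apply: (@le_lt_trans _ _ (`|C|%:E * mu D)%E).
    apply: integral_le_bound => //; apply: filterS2 eqF FC => x eqFx FC Dx.
    by rewrite -eqFx// gee0_abs ?F0// (le_trans (FC Dx))// lee_fin ler_norm.
  by rewrite lte_mul_pinfty// lee_fin.
split => //; rewrite (ae_eq_integral _ _ mD mF mfF eqF).
by rewrite /Rintegral fineK//; exact: integrable_fin_num.
Qed.

(** Extending [f] by zero off the slab reduces the claim to Tonelli on the whole product, since
    sections over points outside [A] then integrate to zero. *)
Lemma tonelli_slab d1 d2 (T1 : measurableType d1) (T2 : measurableType d2)
    (R : realType) (m1 : {sigma_finite_measure set T1 -> \bar R})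
    (m2 : {sigma_finite_measure set T2 -> \bar R})
    (A : set T1) (f : T1 * T2 -> R) :
  measurable A -> measurable_fun (A `*` setT) f ->
  (forall x, (A `*` setT) x -> 0 <= f x) ->
  measurable_fun A (fun x => \int[m2]_y (f (x, y))%:E)%E /\
  (\int[m1 \x m2]_(z in A `*` setT) (f z)%:E =
   \int[m1]_(x in A) \int[m2]_y (f (x, y))%:E)%E.
Proof.
move=> mA mf f0; have mAT : measurable (A `*` [set: T2]) by exact: measurableX.
pose h := (EFin \o f) \_ (A `*` setT).
have mh : measurable_fun setT h.
  by apply/(measurable_restrictT _ mAT)/measurable_EFinP.
have h0 z : (0 <= h z)%E.
  by rewrite /h patchE; case: ifPn => // /[!inE] zA; rewrite lee_fin f0.
have hE : fubini_F m2 h =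
    (fun x => \int[m2]_y (f (x, y))%:E)%E \_ A.
  apply/funext => x; rewrite patchE /fubini_F; case: ifPn => [/[!inE] Ax|Ax].
    by apply: eq_integral => y _; rewrite /h patchE mem_set.
  rewrite integral0_eq// => y _; rewrite /h patchE memNset//= => -[/= Ax' _].
  by rewrite mem_set in Ax.
split.
  apply/(measurable_restrictT _ mA); rewrite -hE.
  exact: measurable_fun_fubini_tonelli_F.
by rewrite integral_mkcond fubini_tonelli1// hE -integral_mkcond.
Qed.

Lemma measurable_slab_section d1 d2 d3 (T1 : measurableType d1)
    (T2 : measurableType d2) (T3 : measurableType d3) (A : set T1)
    (f : T1 * T2 -> T3) (x : T1) :
  measurable A -> A x -> measurable_fun (A `*` setT) f ->
  measurable_fun setT (fun y => f (x, y)).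
Proof.
move=> mA Ax mf; apply: (@measurable_comp _ _ _ _ _ _ (A `*` setT) f setT (pair x)) => //.
- exact: measurableX.
- by move=> _ [y _ <-].
Qed.

(** * Values of the interpolant and the constant test function *)

Lemma interpolantE {R : realType} {d : nat} (tau : R) (N : nat)
    (u : nat -> torus R d -> R) (t : R) :
  0 < tau -> 0 < t <= N%:R * tau ->
  exists2 n, (n < N)%N & interpolant tau N u t = u n.+1.
Proof.
move=> tau0 /andP[t0 tN].
have exn : exists n, t <= n.+1%:R * tau.
  by exists N; rewrite (le_trans tN)// ler_pM2r// ler_nat.
(* The least such [n] indexes the half-open step containing [t]: minimality gives the strict left
   bound, which for [n = 0] is [0 < t]. *)
have [n tn nmin] := ex_minnP exn.
have nt : n%:R * tau < t.
  case: n tn nmin => [|n] tn nmin; first by rewrite mul0r.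
  by rewrite ltNge; apply/negP => /nmin; rewrite ltnn.
have nN : (n < N)%N.
  by rewrite -(ltr_nat R) -(ltr_pM2r tau0) (lt_le_trans nt).
exists n => //; apply/funext => x; rewrite /interpolant (bigD1 (Ordinal nN))//=.
rewrite indicE mem_set ?mul1r; last by rewrite /= in_itv/= nt.
(* If step [m] also contained [t], minimality would give [n <= m], and [m * tau < t <= n.+1 * tau]
   would give [m <= n]. *)
rewrite big1 ?addr0// => m mn; rewrite indicE memNset ?mul0r//=.
rewrite in_itv/= => /andP[mt tm]; move/eqP: mn; apply; apply: val_inj => /=.
apply/eqP; rewrite eqn_leq nmin// andbT -ltnS -(ltr_nat R) -(ltr_pM2r tau0).
exact: lt_le_trans tn.
Qed.

Lemma one_in_L1C {R : realType} (d : nat) (T : R) :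
  in_L1C T (fun _ (_ : torus R d) => 1).
Proof.
have supc (c : R) : sup_norm (fun _ : torus R d => c) = `|c|%:E.
  apply/eqP; rewrite eq_le; apply/andP; split.
    by apply: ge_ereal_sup => _ [x _ <-].
  (* A point of the torus is required: the supremum over an empty set would be [-oo]. *)
  by apply: ereal_sup_ubound; exists point.
split.
- by move=> t _; exact: cst_continuous.
- exists (fun _ _ _ => 1); split => [n|t _].
    exists 1%N, (fun _ => setT), (fun _ _ => 1); split.
      by move=> _; split => //; exact: cst_continuous.
    by move=> t x; rewrite big_ord1 indicT mul1r.
  by under eq_fun do rewrite subrr supc normr0; exact: cvg_cst.
- under eq_integral do rewrite supc normr1.
  rewrite integral_cst//= mul1e lebesgue_measure_itv/=.
  by case: ifPn => // _; rewrite -EFinD ltry.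
Qed.

(** * Vanishing of the defect measure *)

Theorem proposition3p22 (R : realType) (d : nat) (T q eps : R)
  (d13 : (1 <= d <= 3)%N) (T_gt0 : 0 < T)
  (q_gt1 : 1 < q) (q_ged : d%:R <= q) (eps_gt0 : 0 < eps)
  (h tau : nat -> R) (N : nat -> nat)
  (h_gt0 : forall k, 0 < h k) (tau_gt0 : forall k, 0 < tau k)
  (Ntau : forall k, (N k)%:R * tau k = T)
  (h_cvg0 : h k @[k --> \oo] --> (0 : R))
  (tau_cvg0 : tau k @[k --> \oo] --> (0 : R))
  (M : nat -> torus_mesh R d) (M_size : forall k, mesh_size (M k) = h k)
  (th : nat -> nat -> torus R d -> R)
  (th_gt0 : forall k n x, (n <= N k)%N -> 0 < th k n x)
  (th_continuous : forall k n, (n <= N k)%N -> continuous (th k n))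
  (th_affine : forall k n, (n <= N k)%N -> piecewise_affine (M k) (th k n))
  (th_bound : exists C : R, forall k n, (n <= N k)%N ->
     (\int[dx]_x (th k n x + th k n x `^ (- q))%:E <= C%:E)%E)
  (theta : R -> torus R d -> R)
  (theta_gt0 : {ae dtdx, forall p, QT T p -> 0 < theta p.1 p.2})
  (theta_L2H1 : in_L2H1 T theta)
  (theta_LinftyL1 : in_LinftyL1 T (fun t x => theta t x `^ (- q)))
  (theta_cvgL2 :
     (\int[dtdx]_(p in QT T)
       ((interpolant (tau k) (N k) (th k) p.1 p.2 - theta p.1 p.2) ^+ 2)%:E)%E
     @[k --> \oo] --> 0%E)
  (theta_cvg_ae : {ae dtdx, forall p, QT T p ->
     interpolant (tau k) (N k) (th k) p.1 p.2 @[k --> \oo] --> theta p.1 p.2})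
  (lambda : R -> {finite_measure set (torus R d) -> \bar R})
  (lambda_Linfty : in_Linfty_weakstar T lambda) :
  let g k t x := eps * interpolant (tau k) (N k) (th k) t x `^ (- q) in
  let g_lim t x := eps * theta t x `^ (- q) in
  weakstar_cvg T (fun k t => of_density (g k t))
    (fun t phi => of_density (g_lim t) phi + of_measure (lambda t) phi) ->
  [\/ uniformly_integrable T g,
      (\int[dtdx]_(p in QT T) (g k p.1 p.2)%:E)%E @[k --> \oo] -->
        (\int[dtdx]_(p in QT T) (g_lim p.1 p.2)%:E)%E
    | exists2 delta : R, 0 < delta &
        (ereal_sup [set \int[dtdx]_(p in QT T) (g k p.1 p.2 `^ (1 + delta))%:E
                   | k in [set: nat]] < +oo)%E] ->
  {ae (@lebesgue_measure R), forall t, t \in `]0, T[ ->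
    forall A, measurable A -> lambda t A = 0%E}.
Proof.
move=> g g_lim wk conds.
pose leb : {measure set (measurableTypeR R) -> \bar R} := @lebesgue_measure R.
pose I : set (measurableTypeR R) := `]0, T[%classic.
have mI : measurable I by exact: measurable_itv.
have muI : (leb I < +oo)%E.
  rewrite [leb I](lebesgue_measure_itv `]0, T[)/= lte_fin T_gt0.
  by rewrite -EFinD ltry.
have mQ : measurable (QT T : set (measurableTypeR R * torus R d)).
  exact: measurableX.
have muQ : (dtdx (QT T : set (measurableTypeR R * torus R d)) < +oo)%E.
  rewrite /dtdx product_measure1E//.
  by rewrite [X in (_ * X)%E](@probability_setT _ _ R dx) mule1.
have g0 k t x : 0 <= g k t x by rewrite /g mulr_ge0 ?powR_ge0// ltW.
have gl0 t x : 0 <= g_lim t x by rewrite /g_lim mulr_ge0 ?powR_ge0// ltW.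
have mg k : measurable_fun (QT T) (fun p => g k p.1 p.2).
  apply: measurable_funTS; apply: measurable_funM; first exact: measurable_cst.
  apply: (measurableT_comp (measurable_powR _)).
  exact: measurable_interpolant (th_continuous k).
have [mpl [C1 C1le]] := theta_LinftyL1.
have mgl : measurable_fun (QT T) (fun p => g_lim p.1 p.2).
  by apply: measurable_funM; first exact: measurable_cst.
have gcvg : {ae dtdx, forall p, QT T p ->
    g k p.1 p.2 @[k --> \oo] --> g_lim p.1 p.2}.
  apply: filterS2 theta_gt0 theta_cvg_ae => p thp thc Qp.
  apply: cvgM; first exact: cvg_cst.
  by apply: cvg_powR; [exact: thp | exact: thc].
(* [F k] and [G] are the spatial masses at time [t]; bounding them makes their time integrals
   finite, as the real-valued weak-star pairing demands. *)
pose F k t := (\int[dx]_x (g k t x)%:E)%E.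
pose G t := (\int[dx]_x (g_lim t x)%:E)%E.
have mfF k : measurable_fun I (F k) /\
    (\int[dtdx]_(p in QT T) (g k p.1 p.2)%:E = \int[leb]_(t in I) F k t)%E.
  exact: (@tonelli_slab _ _ _ _ R (@lebesgue_measure R) dx I
    (fun p => g k p.1 p.2)).
have mfG : measurable_fun I G /\
    (\int[dtdx]_(p in QT T) (g_lim p.1 p.2)%:E = \int[leb]_(t in I) G t)%E.
  exact: (@tonelli_slab _ _ _ _ R (@lebesgue_measure R) dx I
    (fun p => g_lim p.1 p.2)).
have F0 k t : I t -> (0 <= F k t)%E.
  by move=> _; apply: integral_ge0 => x _; rewrite lee_fin.
have G0 t : I t -> (0 <= G t)%E.
  by move=> _; apply: integral_ge0 => x _; rewrite lee_fin.
have [C0 C0le] := th_bound.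
have FC k t : I t -> (F k t <= (eps * C0)%:E)%E.
  rewrite /I/= in_itv/= => /andP[t0 tT].
  have [|n nN itE] := @interpolantE _ _ (tau k) (N k) (th k) t (tau_gt0 k).
    by rewrite t0 Ntau ltW.
  have mth : measurable_fun setT (th k n.+1).
    exact: continuous_torus_measurable (th_continuous k n.+1 nN).
  have mthq : measurable_fun setT (fun x => th k n.+1 x `^ (- q)).
    exact: (measurableT_comp (measurable_powR _)).
  (* At time [t] the interpolant is [th k n.+1]; positivity of this function allows adding it to the
     integrand, which gives the quantity controlled by [th_bound]. *)
  rewrite EFinM; apply: le_trans (lee_wpmul2l _ (C0le k n.+1 nN)); last first.
    by rewrite lee_fin ltW.
  have pos x : 0 <= th k n.+1 x + th k n.+1 x `^ (- q).
    by rewrite addr_ge0 ?powR_ge0 ?ltW ?th_gt0.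
  rewrite -ge0_integralZl//; last 3 first.
  - by apply/measurable_EFinP; exact: measurable_funD.
  - by move=> x _; rewrite lee_fin.
  - by rewrite lee_fin ltW.
  apply: ge0_le_integral => //.
  - by move=> x _; rewrite lee_fin.
  - apply/measurable_EFinP; rewrite /g itE; apply: measurable_funM => //.
  - apply: measurable_funeM; apply/measurable_EFinP; exact: measurable_funD.
  move=> x _; rewrite -EFinM lee_fin /g itE ler_pM2l// lerDr.
  by rewrite ltW ?th_gt0.
have GC : {ae leb, forall t, I t -> (G t <= (eps * C1)%:E)%E}.
  apply: (@filterS _ (almost_everywhere leb)) C1le => t tC It.
  have Cle := tC It.
  have mpt : measurable_fun setT (fun x => theta t x `^ (- q)).
    exact: (@measurable_slab_section _ _ _ _ _ _ I
      (fun p => theta p.1 p.2 `^ (- q)) t).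
  rewrite EFinM; apply: le_trans (lee_wpmul2l _ Cle); last by rewrite lee_fin ltW.
  rewrite -ge0_integralZl//; last 2 first.
  - by apply/measurable_EFinP; exact: measurableT_comp.
  - by rewrite lee_fin ltW.
  rewrite le_eqVlt; apply/orP; left; apply/eqP; apply: eq_integral => x _.
  by rewrite -EFinM ger0_norm ?powR_ge0.
have [mLam [C2 C2le]] := lambda_Linfty.
have LamE t : of_measure (lambda t) (fun _ => 1) = fine (lambda t setT).
  by rewrite /of_measure Rintegral_cst// mul1r.
have Lamfin t : (lambda t setT : \bar R) \is a fin_num.
  exact: fin_num_measure.
have mL : measurable_fun I (fun t => lambda t setT : \bar R).
  (* Weak-star measurability concerns pairings with continuous functions; pairing with 1 yields the
     total mass. *)
  have mone : measurable_fun I (fun t => fine (lambda t setT)).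
    have cone : continuous (fun _ : torus R d => 1 : R) by exact: cst_continuous.
    by apply: eq_measurable_fun (mLam _ cone) => t _; rewrite LamE.
  move/measurable_EFinP : mone; apply: eq_measurable_fun => t _ /=.
  by rewrite fineK.
have EF k : (\int[leb]_(t in I) F k t = (\int[leb]_(t in I) fine (F k t))%:E)%E.
  have [_ ->//] := ae_bounded_integral_fine mI muI (mfF k).1 (F0 k)
    (aeW leb (FC k)).
have [intG EG] := ae_bounded_integral_fine mI muI mfG.1 G0 GC.
have [intL EL] := ae_bounded_integral_fine mI muI mL
  (fun t _ => measure_ge0 (lambda t) setT) C2le.
set a := \int[leb]_(t in I) fine (G t) in EG.
set b := \int[leb]_(t in I) fine (lambda t setT) in EL.
have mass_cvg : (\int[dtdx]_(p in QT T) (g k p.1 p.2)%:E)%E @[k --> \oo] -->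
    (a + b)%:E.
  (* [Rintegral] is the [fine] part of an integral, so the pairings with 1 are [fine (F k t)] and
     [fine (G t) + fine (lambda t setT)]; the finiteness results turn their time integrals into
     space-time masses. *)
  have := wk _ (one_in_L1C d T).
  rewrite [X in _ --> X](_ : _ = a + b); last first.
    rewrite -RintegralD//; apply: eq_Rintegral => t _.
    by rewrite LamE /of_density/Rintegral; under eq_integral do rewrite mul1r.
  move=> wk1; apply: cvg_EFin.
    by apply: nearW => k; rewrite (mfF k).2 EF.
  apply: cvg_trans wk1; apply: near_eq_cvg; apply: nearW => k /=.
  rewrite (mfF k).2 EF/=; apply: eq_Rintegral => t _.
  by rewrite /of_density/Rintegral; under eq_integral do rewrite mul1r.
have b_le0 : b <= 0.
  (* The mass of the limit density is the finite number [a], which can be cancelled. *)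
  suff : ((a + b)%:E <= \int[dtdx]_(p in QT T) (g_lim p.1 p.2)%:E)%E.
    by rewrite mfG.2 EG lee_fin gerDl.
  have tight_le := tight_integral_limit_le mQ muQ mg mgl
    (fun k p _ => g0 k p.1 p.2) (fun p _ => gl0 p.1 p.2) gcvg.
  case: conds => [ui|mass|[delta d0 bdd]].
  - apply: tight_le mass_cvg => e e0.
    (* The supremum over [k] may be infinite at low heights; convergence to 0 gives a positive
       height [B] where it is both finite and below [e]. *)
    have /fine_cvgP[uifin uilim] := ui.
    have [B B0 [Bfin Be]] := pinfty_ex_gt0 (filterI uifin (cvgr_lt _ uilim e e0)).
    exists B => // k; apply: (@le_trans _ _ (fine (ereal_sup [set
      (\int[dtdx]_(p in QT T) (g j p.1 p.2 * \1_[set y | B < y] (g j p.1 p.2))%:E)%E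
      | j in [set: nat]]))%:E); last by rewrite lee_fin ltW.
    by rewrite fineK//; apply: ereal_sup_ubound; exists k.
  - by rewrite (cvg_unique _ mass_cvg mass).
  - by apply: tight_le mass_cvg; exact: bounded_moments_tight bdd.
(* The total mass of [lambda t] is nonnegative with time integral [b <= 0], hence zero for almost
   every [t]. *)
have intL0 : (\int[leb]_(t in I) `|lambda t setT : \bar R| = 0)%E.
  under eq_integral do rewrite gee0_abs//.
  apply/eqP; rewrite eq_le integral_ge0 ?andbT//.
  by rewrite EL lee_fin.
have /(ae_eq_integral_abs leb mI mL) := intL0.
(* The exceptional times come from the total mass alone, so they do not depend on [A]; monotonicity
   of the measure then covers every measurable [A]. *)
apply: filterS => t lam0 It A mA; apply/eqP; rewrite -measure_le0.
have <- : lambda t setT = 0%E by exact: lam0.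
by apply: le_measure; rewrite ?inE.
Qed.
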